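(* Let $f:A\to B$ be a homomorphism of commutative rings with unity, let $J$ be an ideal of $B$, and let $A\bowtie^f J=\{(a,f(a)+j)\mid a\in A,\ j\in J\}\subseteq A\times B$. Set $X:=\mathrm{Spec}(A)$, $Y:=\mathrm{Spec}(B)$, $W:=\mathrm{Spec}(A\bowtie^f J)$, $J_0:=\{0\}\times J$ and $J_1:=f^{-1}(J)\times\{0\}$ (ideals of $A\bowtie^f J$). For $P\in X$ and $Q\in Y$ set $$P^{\prime_f}:=\{(p,f(p)+j)\mid p\in P,\ j\in J\},\qquad \overline{Q}^{f}:=\{(a,f(a)+j)\mid a\in A,\ j\in J,\ f(a)+j\in Q\}.$$ Then: (1) The map $P\mapsto P^{\prime_f}$ establishes a closed embedding of $X$ into $W$, so its image, which coincides with $V(J_0)$, is homeomorphic to $X$. (2) The map $Q\mapsto \overline{Q}^f$ is a homeomorphism of $Y\setminus V(J)$ onto $W\setminus V(J_0)$. (3) The prime ideals of $A\bowtie^f J$ are those of the type $P^{\prime_f}$ or $\overline{Q}^f$, for $P$ varying in $X$ and $Q$ varying in $Y\setminus V(J)$. (4) $W=V(J_0)\cup V(J_1)$, and the set $V(J_0)\cap V(J_1)$ is homeomorphic to $\mathrm{Spec}((f(A)+J)/J)$ via the continuous map associated to the natural ring homomorphism $\gamma:A\bowtie^f J\to (f(A)+J)/J$, $(a,f(a)+j)\mapsto f(a)+J$. In particular, when $f$ is surjective, the closed subspace $V(J_0)\cap V(J_1)$ of $W$ is homeomorphic to the closed subspace $V(J)$ of $Y$.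
   Context: All spectra carry the Zariski topology. $A\bowtie^f J$ is a subring of $A\times B$, called the amalgamation of $A$ with $B$ along $J$ with respect to $f$. For a subset $S$ of a ring $R$, $V(S)$ denotes the closed set of prime ideals of $R$ containing $S$. The subset $f(A)+J=\{f(a)+j\mid a\in A,\ j\in J\}$ is a subring of $B$ of which $J$ is an ideal. The continuous map associated to a ring homomorphism $g:R\to S$ is $\mathrm{Spec}(S)\to\mathrm{Spec}(R)$, $H\mapsto g^{-1}(H)$. *)

(* Defs.v *)
From HB Require Import structures.
From mathcomp Require Import all_boot all_order all_algebra.
From mathcomp Require Import all_classical topology.

Set Implicit Arguments.
Unset Strict Implicit.
Unset Printing Implicit Defensive.

Import GRing.Theory.

Local Open Scope classical_set_scope.
Local Open Scope ring_scope.
Local Open Scope quotient_scope.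

(* Rings are comPzRingType: the zero ring is allowed, and ideals need not be  *)
(* proper. This is why the ideals and ring quotients of ring_quotient.v,      *)
(* which are restricted to proper ideals of nonzero rings, are not used.      *)

Section Ideals.
Variable R : comPzRingType.

Definition is_ideal (I : set R) : Prop :=
  [/\ I 0, forall x y, I x -> I y -> I (x + y) & forall a x, I x -> I (a * x)].

Definition is_prime_ideal (P : set R) : Prop :=
  [/\ is_ideal P, ~ P 1 & forall x y, P (x * y) -> P x \/ P y].

(* The projections are typed R -> Prop rather than set R so that they can be  *)
(* coerced to functions as well as to sets.                                   *)
Record ideal := Ideal { ideal_set :> R -> Prop; idealP : is_ideal ideal_set }.

Record spec := Spec {
  spec_set :> R -> Prop; specP : is_prime_ideal spec_set }.

Lemma spec_inj (P Q : spec) : P = Q :> set R -> P = Q.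
Proof.
case: P Q => [P hP] [Q hQ] /= PQ; subst Q.
by congr Spec; exact: Prop_irrelevance.
Qed.

Lemma ideal0 (I : ideal) : I 0. Proof. by case: (idealP I). Qed.

Lemma idealD (I : ideal) x y : I x -> I y -> I (x + y).
Proof. by case: (idealP I) => _ + _; apply. Qed.

Lemma idealMl (I : ideal) a x : I x -> I (a * x).
Proof. by case: (idealP I) => _ _; apply. Qed.

Lemma idealMr (I : ideal) a x : I x -> I (x * a).
Proof. by rewrite mulrC; exact: idealMl. Qed.

Lemma idealN (I : ideal) x : I x -> I (- x).
Proof. by rewrite -mulN1r; exact: idealMl. Qed.

Lemma idealB (I : ideal) x y : I x -> I y -> I (x - y).
Proof. by move=> Ix /idealN; exact: idealD. Qed.

End Ideals.

Lemma preimage_is_ideal (R S : comPzRingType) (g : {rmorphism R -> S})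
  (I : set S) : is_ideal I -> is_ideal (g @^-1` I).
Proof.
case=> I0 ID IM; split=> [|x y Ix Iy|a x Ix] /=; first by rewrite rmorph0.
- by rewrite rmorphD; exact: ID.
- by rewrite rmorphM; exact: IM.
Qed.

Lemma preimage_is_prime (R S : comPzRingType) (g : {rmorphism R -> S})
  (P : set S) : is_prime_ideal P -> is_prime_ideal (g @^-1` P).
Proof.
case=> iP P1 Pm; split=> [||x y] /=; first exact: preimage_is_ideal.
- by rewrite rmorph1.
- by rewrite rmorphM; exact: Pm.
Qed.

Section Zariski.
Variable R : comPzRingType.

Definition V (S : set R) : set (spec R) := [set P | S `<=` P].

Definition zariski_open (U : set (spec R)) : Prop :=
  exists S : set R, U = ~` V S.

Let zariski_openT : zariski_open setT.
Proof.
exists setT; apply/seteqP; split=> // P _ /(_ 1 Logic.I).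
by case: (specP P).
Qed.

Let zariski_openI : setI_closed zariski_open.
Proof.
move=> _ _ [S ->] [T ->]; exists [set x * y | x in S & y in T].
rewrite -setCU; congr (~` _); apply/seteqP; split=> P.
  have [[_ _ PM] _ _] := specP P.
  move=> [SP|TP] _ [x Sx [y Ty <-]]; last by apply: PM; exact: TP.
  by rewrite mulrC; apply: PM; exact: SP.
have [_ _ Pp] := specP P => STP.
have [SP|/existsNP[x /not_implyP[Sx Px]]] := pselect (S `<=` P); first by left.
right=> y Ty; have /Pp[//|//] : P (x * y).
by apply: STP; exists x => //; exists y.
Qed.

Let zariski_open_bigU (I : Type) (U : I -> set (spec R)) :
  (forall i, zariski_open (U i)) -> zariski_open (\bigcup_i U i).
Proof.
move=> /choice[S US]; exists (\bigcup_i S i).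
apply/seteqP; split=> [P [i _]|P SP].
  by rewrite US => SiP SP; apply: SiP => x Six; apply: SP; exists i.
apply: contrapT => UP; apply: SP => x [i _ Six].
apply: contrapT => Px; apply: UP; exists i => //.
by rewrite US => /(_ _ Six).
Qed.

HB.instance Definition _ := gen_eqMixin (spec R).
HB.instance Definition _ := gen_choiceMixin (spec R).
HB.instance Definition _ := isOpenTopological.Build (spec R)
  zariski_openT zariski_openI zariski_open_bigU.

Lemma closed_V (S : set R) : closed (V S).
Proof. by rewrite -[V S]setCK; apply: open_closedC; exists S. Qed.

End Zariski.

Definition spec_map (R S : comPzRingType) (g : {rmorphism R -> S})
  (H : spec S) : spec R := Spec (preimage_is_prime g (specP H)).

Definition homeomorphism (T U : topologicalType) (h : T -> U) : Prop :=
  continuous h /\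
  exists g : U -> T, [/\ continuous g, cancel h g & cancel g h].

Definition homeomorphic (T U : topologicalType) : Prop :=
  exists h : T -> U, homeomorphism h.

(* h takes its values in E and is a homeomorphism from T to the set E, where  *)
(* the type [set_type E] of the points of E carries the subspace topology     *)
Definition homeomorphism_onto (T U : topologicalType) (E : set U) (h : T -> U) :
    Prop :=
  exists hE : T -> set_type E,
    (forall x, \val (hE x) = h x) /\ homeomorphism hE.

Definition closed_embedding (T U : topologicalType) (h : T -> U) : Prop :=
  closed (range h) /\ homeomorphism_onto (range h) h.

Section QuotientRing.
Variables (R : comPzRingType) (I : ideal R).

Definition ideal_pred : {pred R} := fun x => x \in (I : set R).

Let ideal_pred_zmod : zmod_closed ideal_pred.
Proof.
split=> [|x y]; rewrite ?unfold_in; first exact/mem_set/ideal0.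
by move=> /set_mem Ix /set_mem Iy; exact/mem_set/idealB.
Qed.
HB.instance Definition _ := GRing.isZmodClosed.Build R ideal_pred
  ideal_pred_zmod.

Definition quot_ring : Type := Quotient.quot ideal_pred.
HB.instance Definition _ := GRing.Zmodule.on quot_ring.
HB.instance Definition _ := EqQuotient.on quot_ring.

Let q_one : quot_ring := \pi_quot_ring 1.
Let q_mul (x y : quot_ring) : quot_ring := \pi_quot_ring (repr x * repr y).

Let pi_eq (x y : R) : I (x - y) -> \pi_quot_ring x = \pi_quot_ring y.
Proof. by move=> Ixy; apply/eqP; rewrite -Quotient.idealrBE; exact/mem_set. Qed.

Let repr_pi (x : R) : I (repr (\pi_quot_ring x) - x).
Proof.
apply/set_mem; rewrite -[_ \in _]/(_ \in ideal_pred).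
by rewrite Quotient.idealrBE reprK.
Qed.

Let pi_mul (x y : R) : \pi_quot_ring (x * y) = q_mul (\pi_quot_ring x) (\pi_quot_ring y).
Proof.
apply/esym/pi_eq; set x' := repr _; set y' := repr _.
have -> : x' * y' - x * y = (x' - x) * y' + x * (y' - y).
  by rewrite mulrBl mulrBr addrA subrK.
by apply: idealD; [exact/idealMr/repr_pi | exact/idealMl/repr_pi].
Qed.

Let quotP (x : quot_ring) : exists a : R, x = \pi_quot_ring a.
Proof. by exists (repr x); rewrite reprK. Qed.

Let q_mulA : associative q_mul.
Proof.
move=> x y z; have [[a ->] [b ->] [c ->]] := And3 (quotP x) (quotP y) (quotP z).
by rewrite -(pi_mul b) -(pi_mul a b) -(pi_mul a) -(pi_mul _ c) mulrA.
Qed.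

Let q_mulC : commutative q_mul.
Proof. by move=> x y; rewrite /q_mul mulrC. Qed.

Let q_mul1 : left_id q_one q_mul.
Proof. by move=> x; have [a ->] := quotP x; rewrite -(pi_mul 1) mul1r. Qed.

Let q_mulDl : left_distributive q_mul +%R.
Proof.
move=> x y z; have [[a ->] [b ->] [c ->]] := And3 (quotP x) (quotP y) (quotP z).
have pi_add u v : \pi_quot_ring (u + v) =
  \pi_quot_ring u + \pi_quot_ring v :> quot_ring by exact: (@Quotient.pi_add).
by rewrite -pi_add -(pi_mul a) -(pi_mul b) -(pi_mul (a + b)) mulrDl pi_add.
Qed.

HB.instance Definition _ := GRing.Zmodule_isComPzRing.Build quot_ring
  q_mulA q_mulC q_mul1 q_mulDl.

Definition quot_proj : R -> quot_ring := \pi_quot_ring.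

Let quot_proj_zmod : zmod_morphism quot_proj.
Proof. exact: raddfB. Qed.
HB.instance Definition _ := GRing.isZmodMorphism.Build R quot_ring quot_proj
  quot_proj_zmod.

Let quot_proj_monoid : monoid_morphism quot_proj.
Proof. by split=> // x y; exact: pi_mul. Qed.
HB.instance Definition _ := GRing.isMonoidMorphism.Build R quot_ring quot_proj
  quot_proj_monoid.

Lemma quot_proj_eq (x y : R) : quot_proj x = quot_proj y <-> I (x - y).
Proof.
split=> [/eqP|]; last exact: pi_eq.
by rewrite -Quotient.idealrBE => /set_mem.
Qed.

Lemma quot_proj_surj (z : quot_ring) : exists x, quot_proj x = z.
Proof. by exists (repr z); exact: reprK. Qed.

End QuotientRing.

Section Amalgamation.
Variables (A B : comPzRingType) (f : {rmorphism A -> B}) (J : ideal B).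

Definition amalg_set : set (A * B) :=
  [set (a, f a + j) | a in [set: A] & j in J].

Definition amalg_pred : {pred A * B} := fun x => x \in amalg_set.

Let amalg_subring : subring_closed amalg_pred.
Proof.
split=> [|x y|x y]; rewrite ?unfold_in.
- apply/mem_set; exists 1 => //; exists 0; first exact: ideal0.
  by rewrite rmorph1 addr0.
- move=> /set_mem[a _ [i Ji <-]] /set_mem[b _ [j Jj <-]].
  apply/mem_set; exists (a - b) => //; exists (i - j); first exact: idealB.
  by rewrite rmorphB addrACA -opprD.
- move=> /set_mem[a _ [i Ji <-]] /set_mem[b _ [j Jj <-]].
  apply/mem_set; exists (a * b) => //; exists (f a * j + i * (f b + j)).
    by apply: idealD; [exact: idealMl | exact: idealMr].
  by rewrite rmorphM addrA -mulrDr -mulrDl.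
Qed.
Definition amalg : Type := {x : A * B | amalg_pred x}.
HB.instance Definition _ := SubChoice.on amalg.
HB.instance Definition _ := GRing.SubChoice_isSubComPzRing.Build
  (A * B)%type amalg_pred amalg amalg_subring.

(* The subsets of the amalgamation below are given as the preimages, under    *)
(* its inclusion in A * B, of sets that it contains.                          *)

Definition J0_set : set (A * B) := [set 0] `*` J.

Definition J1_set : set (A * B) := (f @^-1` J) `*` [set 0].

Definition prime_fst_set (P : set A) : set (A * B) :=
  [set (p, f p + j) | p in P & j in J].

Definition prime_snd_set (Q : set B) : set (A * B) :=
  [set x | exists a j, [/\ J j, Q (f a + j) & x = (a, f a + j)]].

Lemma J0_set_sub : J0_set `<=` amalg_set.
Proof.
by move=> [_ j] [/= -> Jj]; exists 0 => //; exists j; rewrite // rmorph0 add0r.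
Qed.

Lemma J1_set_sub : J1_set `<=` amalg_set.
Proof.
move=> [a _] [/= Jfa ->]; exists a => //.
by exists (- f a); [exact: idealN | rewrite subrr].
Qed.

Lemma prime_fst_set_sub (P : set A) : prime_fst_set P `<=` amalg_set.
Proof. by move=> _ [p _ [j Jj <-]]; exists p => //; exists j. Qed.

Lemma prime_snd_set_sub (Q : set B) : prime_snd_set Q `<=` amalg_set.
Proof. by move=> _ [a [j [Jj _ ->]]]; exists a => //; exists j. Qed.

Lemma amalg_val_preimageK (S : set (A * B)) : S `<=` amalg_set ->
  [set \val w | w in [set w : amalg | S (\val w)]] = S.
Proof.
move=> SW; apply/seteqP; split=> [_ [w Sw <-]//|x Sx].
have Wx : amalg_pred x by exact/mem_set/SW.
by exists (Sub x Wx); rewrite /= ?SubK.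
Qed.

Let J0_is_ideal : is_ideal [set w : amalg | J0_set (\val w)].
Proof.
split=> [|x y [x1 x2] [y1 y2]|a x [x1 x2]]; split=> //=.
- exact: ideal0.
- by rewrite x1 y1 addr0.
- exact: idealD.
- by rewrite x1 mulr0.
- exact: idealMl.
Qed.

Definition J0 : ideal amalg := Ideal J0_is_ideal.

Let J1_is_ideal : is_ideal [set w : amalg | J1_set (\val w)].
Proof.
split=> [|x y [x1 x2] [y1 y2]|a x [x1 x2]]; split=> //=.
- by rewrite rmorph0; exact: ideal0.
- by rewrite rmorphD; exact: idealD.
- by rewrite x2 y2 addr0.
- by rewrite rmorphM; exact: idealMl.
- by rewrite x2 mulr0.
Qed.

Definition J1 : ideal amalg := Ideal J1_is_ideal.

(* P'_f *)
Definition prime_fst (P : set A) : set amalg :=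
  [set w | prime_fst_set P (\val w)].

(* Q with an overline, indexed by f *)
Definition prime_snd (Q : set B) : set amalg :=
  [set w | prime_snd_set Q (\val w)].

Definition image_add_set : set B := [set f a + j | a in [set: A] & j in J].

Definition image_add_pred : {pred B} := fun x => x \in image_add_set.

Let image_add_subring : subring_closed image_add_pred.
Proof.
split=> [|x y|x y]; rewrite ?unfold_in.
- apply/mem_set; exists 1 => //; exists 0; first exact: ideal0.
  by rewrite rmorph1 addr0.
- move=> /set_mem[a _ [i Ji <-]] /set_mem[b _ [j Jj <-]].
  apply/mem_set; exists (a - b) => //; exists (i - j); first exact: idealB.
  by rewrite rmorphB addrACA -opprD.
- move=> /set_mem[a _ [i Ji <-]] /set_mem[b _ [j Jj <-]].
  apply/mem_set; exists (a * b) => //; exists (f a * j + i * (f b + j)).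
    by apply: idealD; [exact: idealMl | exact: idealMr].
  by rewrite rmorphM addrA -mulrDr -mulrDl.
Qed.

Definition image_add : Type := {x : B | image_add_pred x}.
HB.instance Definition _ := SubChoice.on image_add.
HB.instance Definition _ := GRing.SubChoice_isSubComPzRing.Build
  B image_add_pred image_add image_add_subring.

Let J_is_ideal : is_ideal [set x : image_add | J (\val x)].
Proof.
split=> [|x y Jx Jy|a x Jx] /=; first exact: ideal0.
- exact: idealD.
- exact: idealMl.
Qed.

Definition image_add_ideal : ideal image_add := Ideal J_is_ideal.

Let f_image_add (a : A) : image_add_pred (f a).
Proof.
apply/mem_set; exists a => //; exists 0; first exact: ideal0.
by rewrite addr0.
Qed.

Definition image_add_of (a : A) : image_add := Sub (f a) (f_image_add a).

(* image_add is the ring f(A) + J, and image_add_ideal is J as an ideal of it. *)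
(* As the element w = (a, f a + j) determines a, the class of f a in          *)
(* (f(A) + J) / J is a function of w.                                         *)
Definition gamma (w : amalg) : quot_ring image_add_ideal :=
  quot_proj image_add_ideal (image_add_of (\val w).1).

Let gamma_zmod : zmod_morphism gamma.
Proof.
move=> x y; rewrite /gamma -rmorphB; congr quot_proj.
by apply: val_inj; exact: (rmorphB f (\val x).1 (\val y).1).
Qed.
HB.instance Definition _ := GRing.isZmodMorphism.Build
  amalg (quot_ring image_add_ideal) gamma gamma_zmod.

Let gamma_monoid : monoid_morphism gamma.
Proof.
split=> [|x y]; rewrite /gamma.
  rewrite -(rmorph1 (quot_proj image_add_ideal)); congr quot_proj.
  by apply: val_inj; exact: (rmorph1 f).
rewrite -rmorphM; congr quot_proj.
by apply: val_inj; exact: (rmorphM f (\val x).1 (\val y).1).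
Qed.
HB.instance Definition _ := GRing.isMonoidMorphism.Build
  amalg (quot_ring image_add_ideal) gamma gamma_monoid.

End Amalgamation.

Arguments amalg_set {A B} f J _.
Arguments amalg {A B} f J.
Arguments J0 {A B} f J.
Arguments J1 {A B} f J.
Arguments prime_fst {A B} f J P _.
Arguments prime_snd {A B} f J Q _.
Arguments image_add {A B} f J.
Arguments image_add_ideal {A B} f J.
Arguments gamma {A B} f J w.

(* Main.v *)
Require Import Defs.
From mathcomp Require Import all_boot all_order all_algebra.
From mathcomp Require Import all_classical topology.
Local Open Scope classical_set_scope.
Local Open Scope ring_scope.
Set Implicit Arguments.
Unset Strict Implicit.
Unset Printing Implicit Defensive.
Import GRing.Theory.

(** Everything follows from three ring homomorphisms out of the amalgamation
W of A with B along J: the projections to A and to B, and gamma. The sets P'_f and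
Q-bar are the inverse images of P and Q under the two projections, so P |-> P'_f
and Q |-> Q-bar are maps of spectra.

The projection to A is onto with kernel J0, and gamma is onto with kernel
J0 + J1. A surjective homomorphism g induces a topological embedding of spectra
whose image is the set of primes containing ker g
([spec_map_surj_embedding], [spec_map_surj_range]). Hence Spec A is V(J0), and
the spectrum of (f(A) + J)/J is V(J0 + J1), the intersection of V(J0) and
V(J1).

The projection to B is not onto in general, but it restricts to a bijection
from the ideal J0 of W to the ideal J of B. A homomorphism that identifies an
ideal of its source with an ideal of its target identifies the open complements
of the closed sets that they define ([spec_map_away]); geometrically, inverting
any element of the common ideal makes the two rings equal. Hence the complement
of V(J) in Spec B is the complement of V(J0) in Spec W. Since a prime of W
either contains J0 or does not, these two descriptions cover all of Spec W.

Finally J0 * J1 = 0, so that every prime of W contains J0 or J1. When f is onto,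
so is the projection to B, with kernel J1; it thus embeds Spec B onto V(J1), and
its restriction to V(J) has image the intersection of V(J0) and V(J1)
because the image of J0 in B is J. *)

(** * Topological embeddings *)

(** The range is left out of this notion so that embeddings compose and restrict
to subspaces before their images are computed. *)
Definition topological_embedding (T U : topologicalType) (h : T -> U) : Prop :=
  [/\ continuous h, injective h &
      forall O : set T, open O -> exists2 O' : set U, open O' & O = h @^-1` O'].

Lemma topological_embedding_comp (T U S : topologicalType) (h : T -> U)
  (k : U -> S) : topological_embedding h -> topological_embedding k ->
  topological_embedding (k \o h).
Proof.
move=> [hc hi ho] [kc ki ko]; split.
- by move=> x; apply: continuous_comp; [exact: hc|exact: kc].
- exact: inj_comp.
- by move=> O /ho[_ /ko[O' oO' ->] ->]; exists O'.
Qed.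

Lemma topological_embedding_val (T : topologicalType) (E : set T) :
  topological_embedding (\val : set_type E -> T).
Proof.
split; [exact: initial_continuous | exact: val_inj |].
by move=> _ [O' oO' <-]; exists O'.
Qed.

Lemma embedding_homeomorphism_onto (T U : topologicalType) (h : T -> U)
  (E : set U) : topological_embedding h -> range h = E ->
  homeomorphism_onto E h.
Proof.
move=> [hc hi ho] hE; have Eh x : h x \in E by apply/mem_set; rewrite -hE; exists x.
have /choice[g gP] (y : set_type E) : exists x, h x = \val y.
  have /(_ _ (set_mem (valP y)))[x _ xy] : E `<=` range h by rewrite hE.
  by exists x.
exists (fun x => exist _ (h x) (Eh x)); split=> //; split.
  by apply/continuousP => _ [O oO <-]; exact: (proj1 (continuousP h) hc).
exists g; split.
- apply/continuousP => O /ho[O' oO' ->]; exists O' => //.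
  by apply/seteqP; split=> y /=; rewrite gP.
- by move=> x; apply: hi; rewrite gP.
- by move=> y; apply: val_inj; rewrite /= gP.
Qed.

Lemma homeomorphism_onto_homeomorphic (T U : topologicalType) (E : set U)
  (h : T -> U) : homeomorphism_onto E h -> homeomorphic (set_type E) T.
Proof.
move=> [hE [_ [hc [g [gc hK gK]]]]]; exists g; split=> //.
by exists hE; split.
Qed.

(** * Spectra of surjective homomorphisms *)

Section SpecMap.
Variables (R S : comPzRingType) (g : {rmorphism R -> S}).

Lemma spec_map_continuous : continuous (spec_map g).
Proof.
apply/continuousP => _ [T ->]; exists (g @` T).
rewrite preimage_setC; congr (~` _); apply/seteqP; split=> Q /= TQ.
- by move=> _ [r Tr <-]; exact: TQ.
- by move=> r Tr; apply: TQ; exists r.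
Qed.

Hypothesis g_surj : forall s, exists r, g r = s.

(** As g is onto, a subset T of S lies in a prime Q exactly when g^-1(T) lies in
g^-1(Q), so the open set defined by T comes from the one defined by
g^-1(T). *)
Lemma spec_map_surj_embedding : topological_embedding (spec_map g).
Proof.
split; first exact: spec_map_continuous.
- move=> P Q PQ; apply/spec_inj/funext => s; have [r <-] := g_surj s.
  exact: (congr1 (fun H : spec R => H r) PQ).
- move=> _ [T ->]; exists (~` V (g @^-1` T)); first by exists (g @^-1` T).
  rewrite preimage_setC; congr (~` _); apply/seteqP; split=> Q TQ.
  + by move=> r; exact: TQ.
  + by move=> s Ts; have [r rs] := g_surj s; rewrite -rs; apply: TQ; rewrite /= rs.
Qed.

(** The prime lying over a prime H that contains the kernel is the direct image
g(H): no element outside H is sent into it, because two elements with the same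
image differ by an element of the kernel, hence of H. *)
Lemma spec_map_surj_range : range (spec_map g) = V (g @^-1` [set 0]).
Proof.
apply/seteqP; split=> [_ [Q _ <-] r /= ->|H kerH].
  by have [[]] := specP Q.
have [[H0 HD HM] H1 Hp] := specP H.
have Hg r : (g @` H) (g r) -> H r.
  move=> [r' Hr' rr']; rewrite -[r](subrK r'); apply: HD => //.
  by apply: kerH; rewrite /= rmorphB rr' subrr.
have gH : is_prime_ideal (g @` H).
  split; first split.
  - by exists 0; rewrite ?rmorph0.
  - by move=> _ _ [x Hx <-] [y Hy <-]; exists (x + y); rewrite ?rmorphD//; exact: HD.
  - move=> s _ [x Hx <-]; have [r <-] := g_surj s.
    by exists (r * x); rewrite ?rmorphM//; exact: HM.
  - by rewrite -(rmorph1 g) => /Hg.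
  - move=> s t; have [x <-] := g_surj s; have [y <-] := g_surj t.
    by rewrite -rmorphM => /Hg /Hp[?|?]; [left; exists x | right; exists y].
exists (Spec gH) => //; apply/spec_inj/seteqP; split=> r; first exact: Hg.
by exists r.
Qed.

End SpecMap.

(** * Homomorphisms that identify an ideal with an ideal *)

Lemma notin_V (T : comPzRingType) (I : set T) (P : spec T) :
  (~` V I) P -> exists2 x, I x & ~ P x.
Proof. by move=> /existsNP[x /not_implyP[]]; exists x. Qed.

Section SpecMapAway.
Variables (R S : comPzRingType) (g : {rmorphism R -> S}).
Variables (K : ideal R) (L : ideal S).
Hypothesis gK : g @` K = L.
Hypothesis g_inj : forall k, K k -> g k = 0 -> k = 0.

Let gL k : K k -> L (g k).
Proof. by move=> Kk; rewrite -[L _]/((L : set S) _) -gK; exists k. Qed.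

Let Lg l : L l -> exists2 k, K k & g k = l.
Proof. by rewrite -[L _]/((L : set S) _) -gK. Qed.

Let g_eq k k' : K k -> K k' -> g k = g k' -> k = k'.
Proof.
move=> Kk Kk' e; apply/eqP; rewrite -subr_eq0; apply/eqP/g_inj.
  exact: idealB.
by rewrite rmorphB e subrr.
Qed.

(** For H prime and K not contained in H, this is the prime of S over H, namely
the inverse image of the extension of H under S -> S_(g k) = R_k, for any k in K
outside H. As g identifies K with the ideal L, multiplication by s in S acts on
K, and the condition says that s K is contained in H. Phrasing it with all k at once avoids choosing one, and localizing. *)
Definition extension_away (H : set R) : set S :=
  [set s | forall k k', K k -> K k' -> g k' = s * g k -> H k'].

Lemma extension_away_prime (H : spec R) : (~` V K) H ->
  is_prime_ideal (extension_away H).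
Proof.
move=> /notin_V[k0 Kk0 Hk0]; have [[H0 HD HM] H1 Hp] := specP H.
have lift s k : K k -> exists2 k', K k' & g k' = s * g k.
  by move=> Kk; apply: Lg; apply/idealMl/gL.
split; first split.
- by move=> k k' Kk Kk'; rewrite mul0r => /(g_inj Kk') ->.
- move=> s t Hs Ht k k' Kk Kk' e.
  have [x Kx xe] := lift s k Kk; have [y Ky ye] := lift t k Kk.
  have -> : k' = x + y.
    by apply: g_eq => //; [exact: idealD | rewrite rmorphD xe ye -mulrDl].
  by apply: HD; [exact: (Hs k) | exact: (Ht k)].
- move=> s t Ht k k' Kk Kk' e; have [x Kx xe] := lift s k Kk.
  by apply: (Ht x) => //; rewrite e xe mulrCA mulrA.
- by move=> /(_ k0 k0 Kk0 Kk0); rewrite mul1r => /(_ erefl).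
- move=> s t Hst; apply: contrapT => /not_orP[].
  move=> /existsNP[k /existsNP[k' /not_implyP[Kk]]].
  move=> /not_implyP[Kk' /not_implyP[ke nk]].
  move=> /existsNP[l /existsNP[l' /not_implyP[Kl]]].
  move=> /not_implyP[Kl' /not_implyP[le nl]].
  have /Hp[//|//] : H (k' * l').
  apply: (Hst (k * l)); [exact: idealMl | exact: idealMl |].
  by rewrite !rmorphM ke le mulrACA.
Qed.

Lemma extension_awayK (H : spec R) : (~` V K) H ->
  g @^-1` extension_away H = H.
Proof.
move=> /notin_V[k0 Kk0 Hk0]; have [[H0 HD HM] H1 Hp] := specP H.
apply/seteqP; split=> r /=.
  move=> /(_ k0 (r * k0) Kk0 (idealMl _ Kk0)); rewrite rmorphM => /(_ erefl).
  by move=> /Hp[].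
move=> Hr k k' Kk Kk' e; have -> : k' = r * k.
  by apply: g_eq => //; [exact: idealMl | rewrite rmorphM].
by rewrite mulrC; exact: HM.
Qed.

(** A prime Q of S that does not contain L = g(K) omits some g k with k in K,
and then s belongs to Q if and only if s * g k does; as s * g k is the image of an
element of K, membership in Q is decided by g^-1(Q). This yields injectivity,
and, applied to every element of a subset T of S, the closed set of R from
which the one defined by T is pulled back. *)
Lemma spec_map_away : homeomorphism_onto (~` V K)
  (spec_map g \o (\val : set_type (~` V L) -> spec S)).
Proof.
have outL (Q : set_type (~` V L)) : exists2 k, K k & ~ (\val Q : spec S) (g k).
  have /notin_V[_ /Lg[k Kk <-] Qk] : (~` V L) (\val Q) := set_mem (valP Q).
  by exists k.
apply: embedding_homeomorphism_onto; last first.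
  apply/seteqP; split=> [_ [Q _ <-]|H HK].
    by have [k Kk Qk] := outL Q => /(_ k Kk).
  pose Q := Spec (extension_away_prime HK).
  have gQ : spec_map g Q = H by apply/spec_inj/extension_awayK.
  have QL : Q \in ~` V L.
    apply/mem_set => LQ; apply: (HK) => k Kk; rewrite -gQ; apply: LQ; exact: gL.
  by exists (exist _ Q QL).
split.
- by move=> Q; apply: continuous_comp;
    [exact: initial_continuous | exact: spec_map_continuous].
- have sub (P Q : set_type (~` V L)) : spec_map g (\val P) = spec_map g (\val Q) ->
    (\val P : spec S) `<=` (\val Q : spec S).
    move=> PQ s Ps; have [k Kk Qk] := outL Q.
    have [[_ _ PM] _ _] := specP (\val P); have [_ _ Qp] := specP (\val Q).
    have [k' Kk' e] := Lg (idealMl s (gL Kk)).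
    have : (spec_map g (\val P)) k' by rewrite /= e mulrC; exact: PM.
    by rewrite PQ /= e => /Qp[].
  move=> P Q PQ; apply/val_inj/spec_inj/seteqP; split; exact: sub.
- move=> _ [_ [T ->] <-].
  pose T' := [set k | K k /\ exists t l, [/\ T t, K l & g k = t * g l]].
  exists (~` V T'); first by exists T'.
  rewrite !preimage_setC; congr (~` _); apply/seteqP; split=> Q /= TQ.
    move=> k [Kk [t [l [Tt Kl e]]]] /=; have [[_ _ QM] _ _] := specP (\val Q).
    by rewrite e mulrC; apply/QM/TQ.
  move=> t Tt; have [k Kk Qk] := outL Q; have [_ _ Qp] := specP (\val Q).
  have [k' Kk' e] := Lg (idealMl t (gL Kk)).
  have : (spec_map g (\val Q)) k'.
    by apply: TQ; split=> //; exists t, k.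
  by rewrite /= e => /Qp[].
Qed.

End SpecMapAway.

(** * The spectrum of the amalgamation *)

Section AmalgamationSpectrum.
Variables (A B : comPzRingType) (f : {rmorphism A -> B}) (J : ideal B).

Definition amalg_fst : {rmorphism amalg f J -> A} := (fst \o \val)%FUN.

Definition amalg_snd : {rmorphism amalg f J -> B} := (snd \o \val)%FUN.

(** The amalgamation consists of the pairs (a, b) with b - f a in J; this form,
used with the next lemma, spares the witnesses in J of its definition. *)
Lemma amalgP (w : amalg f J) : J (amalg_snd w - f (amalg_fst w)).
Proof.
have [a _ [j Jj e]] := set_mem (valP w).
by rewrite /= -e /= addrC addKr.
Qed.

Lemma amalg_mk (a : A) (b : B) : J (b - f a) ->
  exists2 w : amalg f J, amalg_fst w = a & amalg_snd w = b.
Proof.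
move=> Jba; have h : amalg_pred f J (a, b).
  by apply/mem_set; exists a => //; exists (b - f a); rewrite // addrC subrK.
by exists (Sub (a, b) h).
Qed.

Lemma prime_fstE (P : set A) : prime_fst f J P = amalg_fst @^-1` P.
Proof.
apply/seteqP; split=> w /=; first by move=> [p Pp [j _ <-]].
move=> Pw; exists (amalg_fst w) => //; exists (amalg_snd w - f (amalg_fst w)).
  exact: amalgP.
by rewrite addrC subrK [RHS]surjective_pairing.
Qed.

Lemma prime_sndE (Q : set B) : prime_snd f J Q = amalg_snd @^-1` Q.
Proof.
apply/seteqP; split=> w /=; first by move=> [a [j [_ Qj ->]]].
move=> Qw; exists (amalg_fst w), (amalg_snd w - f (amalg_fst w)); split.
- exact: amalgP.
- by rewrite addrC subrK.
- by rewrite addrC subrK [LHS]surjective_pairing.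
Qed.

Lemma amalg_fst_surj (a : A) : exists w, amalg_fst w = a.
Proof.
have [|w wa _] := @amalg_mk a (f a); first by rewrite subrr; exact: ideal0.
by exists w.
Qed.

Lemma amalg_fst_ker : amalg_fst @^-1` [set 0] = J0 f J.
Proof.
apply/seteqP; split=> [w /= w0|w []//]; split=> //=.
by have := amalgP w; rewrite /= w0 rmorph0 subr0.
Qed.

Lemma amalg_snd_J0 : amalg_snd @` J0 f J = J.
Proof.
apply/seteqP; split=> [_ [w [_ Jw] <-]//|j Jj].
have [|w w0 wj] := @amalg_mk 0 j; first by rewrite rmorph0 subr0.
by exists w => //; split; rewrite // -[J _]/(J (amalg_snd w)) wj.
Qed.

Lemma amalg_snd_inj_J0 (w : amalg f J) : J0 f J w -> amalg_snd w = 0 -> w = 0.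
Proof.
move=> [w1 _] w2; apply: val_inj; rewrite rmorph0.
by rewrite [LHS]surjective_pairing; congr pair.
Qed.

Lemma amalg_snd_ker : amalg_snd @^-1` [set 0] = J1 f J.
Proof.
apply/seteqP; split=> [w /= w0|w []//]; split=> //=.
by have := idealN (amalgP w); rewrite /= w0 sub0r opprK.
Qed.

Lemma amalg_snd_surj : (forall b : B, exists a : A, f a = b) ->
  forall b, exists w, amalg_snd w = b.
Proof.
move=> fs b; have [a <-] := fs b.
have [|w _ wb] := @amalg_mk a (f a); first by rewrite subrr; exact: ideal0.
by exists w.
Qed.

(** The two ideals annihilate each other, one having zero first components and
the other zero second components. *)
Lemma V_J0_J1 : [set: spec (amalg f J)] = V (J0 f J) `|` V (J1 f J).
Proof.
apply/seteqP; split=> // H _; apply: contrapT => /not_orP[].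
move=> /notin_V[x [x1 _] Hx] /notin_V[y [_ y2] Hy].
have [[H0 _ _] _ Hp] := specP H.
have xy0 : x * y = 0.
  apply: val_inj; rewrite rmorphM rmorph0 [LHS]surjective_pairing; congr pair => /=.
    by rewrite x1 mul0r.
  by rewrite y2 mulr0.
by have /Hp[] : H (x * y) by rewrite xy0.
Qed.

(** The classes of f a + j and f a modulo J agree, so every class comes from A. *)
Lemma gamma_surj (z : quot_ring (image_add_ideal f J)) :
  exists w, gamma f J w = z.
Proof.
have [x <-] := quot_proj_surj z; have [a _ [j Jj e]] := set_mem (valP x).
have [w wa] := amalg_fst_surj a; exists w.
apply/quot_proj_eq; rewrite -[image_add_ideal f J _]/(J (f (amalg_fst w) - \val x)).
by rewrite wa -e opprD addrA subrr sub0r; exact: idealN.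
Qed.

Lemma gamma_kerE (w : amalg f J) : gamma f J w = 0 <-> J (f (amalg_fst w)).
Proof.
rewrite -(rmorph0 (quot_proj (image_add_ideal f J))); split.
  move=> /quot_proj_eq; rewrite subr0; exact.
by move=> Jw; apply/quot_proj_eq; rewrite subr0.
Qed.

(** The kernel of gamma is J0 + J1: if f a is in J, then (a, b) is the sum of
(0, b) in J0 and (a, 0) in J1. *)
Lemma V_gamma_ker :
  V (gamma f J @^-1` [set 0]) = V (J0 f J) `&` V (J1 f J).
Proof.
apply/seteqP; split=> [H kerH|H [H0 H1]].
  split=> w [w1 w2]; apply: kerH; apply/gamma_kerE => //.
  by rewrite /= w1 rmorph0; exact: ideal0.
move=> w /gamma_kerE Jw; have [[_ HD _] _ _] := specP H.
(* u is the component (a, 0) of w = (a, b) in J1. *)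
have [|u u1 u2] := @amalg_mk (amalg_fst w) 0; first by rewrite sub0r; exact: idealN.
have Ju : J (f (amalg_fst u)) by rewrite u1.
rewrite -[w](subrK u); apply: HD; last by apply: H1; split.
apply: H0; rewrite -amalg_fst_ker /=.
by rewrite -[LHS]/(amalg_fst (w - u)) rmorphB u1 subrr.
Qed.

Lemma spec_fst_range : range (spec_map amalg_fst) = V (J0 f J).
Proof. by rewrite (spec_map_surj_range amalg_fst_surj) amalg_fst_ker. Qed.

Lemma spec_snd_away : homeomorphism_onto (~` V (J0 f J))
  (spec_map amalg_snd \o (\val : set_type (~` V J) -> spec B)).
Proof. exact: (spec_map_away amalg_snd_J0 amalg_snd_inj_J0). Qed.

(** Since J is the image of J0, the prime over Q contains J0 exactly when Q
contains J; it contains J1, the kernel of the projection, in any case. *)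
Lemma spec_snd_V : (forall b : B, exists a : A, f a = b) ->
  homeomorphism_onto (V (J0 f J) `&` V (J1 f J))
    (spec_map amalg_snd \o (\val : set_type (V J) -> spec B)).
Proof.
move=> /amalg_snd_surj snd_surj; apply: embedding_homeomorphism_onto.
  apply: topological_embedding_comp; first exact: topological_embedding_val.
  exact: spec_map_surj_embedding.
rewrite -amalg_snd_ker -(spec_map_surj_range snd_surj).
apply/seteqP; split=> [_ [Q _ <-]|H [H0 [Q _ QH]]].
  split; last by exists (\val Q).
  have QJ : V J (\val Q) := set_mem (valP Q).
  by move=> w [_ Jw]; exact: QJ.
have QJ : Q \in V J.
  apply/mem_set => j; rewrite -amalg_snd_J0 => -[w J0w <-].
  by rewrite -[Q _]/(spec_map amalg_snd Q w) QH; exact: H0.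
by exists (exist _ Q QJ).
Qed.

End AmalgamationSpectrum.

Theorem corollary2p5 (A B : comPzRingType) (f : {rmorphism A -> B})
    (J : ideal B) :
  [/\ (exists iota : spec A -> spec (amalg f J),
         [/\ forall P : spec A, iota P = prime_fst f J P :> set (amalg f J),
             closed_embedding iota,
             range iota = V (J0 f J)
           & homeomorphic (set_type (range iota)) (spec A)]),
      (exists kappa : set_type (~` V J) -> spec (amalg f J),
         (forall Q : set_type (~` V J),
            kappa Q = prime_snd f J (\val Q) :> set (amalg f J)) /\
         homeomorphism_onto (~` V (J0 f J)) kappa),
      (forall H : set (amalg f J),
         is_prime_ideal H <->
         (exists P : spec A, H = prime_fst f J P) \/
         (exists2 Q : spec B, (~` V J) Q & H = prime_snd f J Q))
    & [/\ [set: spec (amalg f J)] = V (J0 f J) `|` V (J1 f J),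
          homeomorphism_onto (V (J0 f J) `&` V (J1 f J)) (spec_map (gamma f J))
        & (forall b : B, exists a : A, f a = b) ->
          homeomorphic (set_type (V (J0 f J) `&` V (J1 f J)))
                       (set_type (V J))]].
Proof.
have fst_onto : homeomorphism_onto (range (spec_map (amalg_fst f J)))
    (spec_map (amalg_fst f J)).
  apply: embedding_homeomorphism_onto => //.
  exact/spec_map_surj_embedding/amalg_fst_surj.
split.
- exists (spec_map (amalg_fst f J)); split.
  + by move=> P; rewrite prime_fstE.
  + by split=> //; rewrite spec_fst_range; exact: closed_V.
  + exact: spec_fst_range.
  + exact: homeomorphism_onto_homeomorphic fst_onto.
- exists (spec_map (amalg_snd f J) \o \val); split.
  + by move=> Q; rewrite prime_sndE.
  + exact: spec_snd_away.
- move=> H; split=> [pH|[[P ->]|[Q _ ->]]]; last 2 first.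
  + by rewrite prime_fstE; exact: preimage_is_prime (specP P).
  + by rewrite prime_sndE; exact: preimage_is_prime (specP Q).
  have [|H0] := pselect (V (J0 f J) (Spec pH)).
    rewrite -spec_fst_range => -[P _ PH]; left; exists P.
    by rewrite prime_fstE; exact: (esym (congr1 (@spec_set _) PH)).
  have [kE [kEE [_ [k [_ _ kK]]]]] := spec_snd_away f J.
  pose Q := k (exist _ (Spec pH) (mem_set H0)).
  right; exists (\val Q); first exact: set_mem (valP Q).
  rewrite prime_sndE; have := kEE Q; rewrite kK => QH.
  exact: (congr1 (@spec_set _) QH).
- split; first exact: V_J0_J1.
  + apply: embedding_homeomorphism_onto.
      exact/spec_map_surj_embedding/gamma_surj.
    by rewrite (spec_map_surj_range (@gamma_surj _ _ f J)) V_gamma_ker.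
  + by move=> /(@spec_snd_V _ _ f J); exact: homeomorphism_onto_homeomorphic.
Qed.
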